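(* Let $F$ be a field of characteristic zero, $f$ an anti-involution of $F^\times$, and $\Phi_f(G)=(G,F^\times,\varphi,f)$ a skew gain graph whose underlying graph $G$ is a double star of order $n$. Then $$\Psi(\Phi_f(G),x)=x^n-a_2x^{n-2}+a_4x^{n-4},\quad a_2=\sum_{e\in E(G)}g(\varphi(e)),\quad a_4=\sum_{M\in\mathcal{M}_2(G)}\prod_{e\in M}g(\varphi(e)).$$ Hence the eigenvalues of $A(\Phi_f(G))$ (in an algebraic closure of $F$, with algebraic multiplicity) are $\pm\sqrt{\frac{a_2-\sqrt{a_2^2-4a_4}}{2}}$ and $\pm\sqrt{\frac{a_2+\sqrt{a_2^2-4a_4}}{2}}$, each with multiplicity $1$, and $0$ with multiplicity $n-4$.
   Context: An anti-involution of $F^\times$ is a map $f:F^\times\to F^\times$ with $f(f(x))=x$ and $f(xy)=f(y)f(x)$. A skew gain graph $(G,F^\times,\varphi,f)$ is a simple graph $G$ with vertices $v_1,\dots,v_n$ and a function $\varphi$ on oriented edges (both orientations of each edge) with values in $F^\times$ satisfying $\varphi(\overrightarrow{vu})=f(\varphi(\overrightarrow{uv}))$. Its adjacency matrix $A$ has $(i,j)$ entry $\varphi(\overrightarrow{v_iv_j})$ if $v_i\sim v_j$ and $0$ otherwise, and $\Psi(\cdot,x)=\det(xI-A)$. $g(x)=xf(x)$, and for an edge $e=uv$, $g(\varphi(e))$ means $g(\varphi(\overrightarrow{uv}))$ (which equals $g(\varphi(\overrightarrow{vu}))$). $\mathcal{M}_2(G)$ is the set of matchings of $G$ with exactly two edges.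 A double star is a tree obtained from two adjacent vertices (the centers) by attaching at least one pendant vertex to each center, i.e. a tree with exactly two non-leaf vertices. Square roots are taken in the algebraic closure of $F$. *)

(* Defs.v *)
From HB Require Import structures.
From mathcomp Require Import all_boot all_order all_algebra.

Set Implicit Arguments.
Unset Strict Implicit.
Unset Printing Implicit Defensive.

Import GRing.Theory.
Local Open Scope ring_scope.

Record sgraph (n : nat) := SGraph {
  adj :> rel 'I_n;
  adj_sym : symmetric adj;
  adj_irr : irreflexive adj }.

Definition degree n (G : sgraph n) (v : 'I_n) : nat := #|[set w | adj G v w]|.

Definition edges n (G : sgraph n) : {set {set 'I_n}} :=
  [set e | [exists u, exists v, adj G u v && (e == [set u; v])]].

(* The edges are nonempty sets, so [trivIset M] says that distinct edges of M
   have no common vertex. *)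
Definition matchings n (G : sgraph n) (k : nat) : {set {set {set 'I_n}}} :=
  [set M : {set {set 'I_n}} | [&& M \subset edges G, trivIset M & #|M| == k]].

(* [ucycle] describes closed walks without repeated vertex; those of size 2 run
   back and forth along one edge and are not cycles of the graph. *)
Definition acyclic n (G : sgraph n) : Prop :=
  forall c : seq 'I_n, ucycle (adj G) c -> (size c <= 2)%N.

Definition is_tree n (G : sgraph n) : Prop :=
  [/\ (0 < n)%N, forall u v, connect (adj G) u v & acyclic G].

Definition double_star n (G : sgraph n) : Prop :=
  is_tree G /\ #|[set v | degree G v != 1%N]| = 2%N.

(* Maps of the multiplicative group of F are maps F -> F preserving the nonzero
   elements; the value at 0 is irrelevant. *)
Definition anti_involution (F : fieldType) (f : F -> F) : Prop :=
  [/\ forall x, x != 0 -> f x != 0,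
      forall x, x != 0 -> f (f x) = x
    & forall x y, x != 0 -> y != 0 -> f (x * y) = f y * f x].

(* The values of [gain] on non-adjacent pairs are irrelevant. *)
Record skew_gain_graph (F : fieldType) (f : F -> F) (n : nat) := SkewGainGraph {
  ugraph : sgraph n;
  gain : 'I_n -> 'I_n -> F;
  gain_neq0 : forall u v, adj ugraph u v -> gain u v != 0;
  gain_rev : forall u v, adj ugraph u v -> gain v u = f (gain u v) }.

Section SkewGainGraph.
Variables (F : fieldType) (f : F -> F) (n : nat) (Phi : skew_gain_graph f n).

Definition gain_adjmx : 'M[F]_n :=
  \matrix_(i, j) (if adj (ugraph Phi) i j then gain Phi i j else 0).

Definition gfun (x : F) : F := x * f x.

(* g(phi(e)), computed on some orientation (u, v) of the edge e; the choice is
   immaterial by [edge_gE]. *)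
Definition edge_g (e : {set 'I_n}) : F :=
  if [pick p : 'I_n * 'I_n | adj (ugraph Phi) p.1 p.2 && (e == [set p.1; p.2])]
    is Some p then gfun (gain Phi p.1 p.2) else 0.

Lemma edge_gE u v : anti_involution f -> adj (ugraph Phi) u v ->
  edge_g [set u; v] = gfun (gain Phi u v).
Proof.
case=> _ fK _ uv; rewrite /edge_g; case: pickP => [[a b] /= | /(_ (u, v))]; last first.
  by rewrite /= uv eqxx.
case/andP=> ab /eqP eqE.
have rev : gfun (gain Phi v u) = gfun (gain Phi u v).
  by rewrite /gfun (gain_rev uv) fK ?(gain_neq0 uv) // mulrC.
have := set21 a b; have := set22 a b; rewrite -eqE !inE.
case/orP=> /eqP eb; case/orP=> /eqP ea; move: ab; rewrite ea eb //.
  by rewrite adj_irr.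
by rewrite adj_irr.
Qed.

Definition coef_a2 : F := \sum_(e in edges (ugraph Phi)) edge_g e.

Definition coef_a4 : F :=
  \sum_(M in matchings (ugraph Phi) 2) \prod_(e in M) edge_g e.

End SkewGainGraph.

Definition is_algebraic_closure (F : fieldType) (K : closedFieldType)
    (iota : {rmorphism F -> K}) : Prop :=
  forall z : K, algebraicOver iota z.

Definition alg_mult (K : fieldType) n (A : 'M[K]_n) (z : K) : nat :=
  mup z (char_poly A).

(* The list s enumerates the eigenvalues of A with algebraic multiplicity:
   coinciding entries of s add up. *)
Definition eigenvalue_list (K : fieldType) n (A : 'M[K]_n) (s : seq K) : Prop :=
  eigenvalue A =i s /\ forall z, alg_mult A z = count_mem z s.

(* Main.v *)
(* Let a, b be the centers. Splitting the rows of the adjacency matrix A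
   according to centers and leaves gives A = U V with U of size n x 4, so
   x^4 det(xI - UV) = x^n det(xI - VU), where VU is the 4 x 4 block matrix
   [[P, D], [1, 0]]: P holds the two gains of the edge ab, and
   D = diag(S_a, S_b) with S_c the sum of g over the pendant edges at c.  Hence
   x^4 det(xI - A) = x^n (x^4 - (g(ab) + S_a + S_b) x^2 + S_a S_b).
   Two disjoint edges are a pendant edge at a and one at b, so the coefficients
   are a_2 and a_4.  The eigenvalues follow from
   x^4 - a_2 x^2 + a_4 = (x^2 - r_1^2) (x^2 - r_2^2). *)
Require Import Defs.
From mathcomp Require Import all_boot all_order all_algebra.
From mathcomp Require Import ring zify.

Set Implicit Arguments.
Unset Strict Implicit.
Unset Printing Implicit Defensive.

Import GRing.Theory.
Local Open Scope ring_scope.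

(* Both sides are determinants of the block matrix [[X, A], [B, 1]] times a
   unitriangular, resp. triangular, factor. *)
Lemma char_poly_mulmxC (R : comNzRingType) m n (A : 'M[R]_(m, n))
    (B : 'M[R]_(n, m)) :
  'X^n * char_poly (A *m B) = 'X^m * char_poly (B *m A).
Proof.
pose A' := map_mx polyC A; pose B' := map_mx polyC B.
pose L := block_mx 'X%:M A' B' 1%:M.
have detL : \det L = char_poly (A *m B).
  have : L *m block_mx 1%:M 0 (- B') 1%:M =
         block_mx (char_poly_mx (A *m B)) A' 0 1%:M.
    rewrite mulmx_block !mulmx1 !mulmx0 !add0r !mulmxN mul1mx subrr.
    by rewrite /char_poly_mx map_mxM.
  move/(congr1 determinant); rewrite det_mulmx det_lblock det_ublock.
  by rewrite !det1 !mulr1.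
rewrite -detL mulrC.
have : L *m block_mx 1%:M (- A') 0 'X%:M =
       block_mx 'X%:M 0 B' (char_poly_mx (B *m A)).
  rewrite mulmx_block !mulmx1 !mulmx0 !addr0 !mulmxN mul1mx.
  rewrite mul_scalar_mx mul_mx_scalar addNr addrC.
  by rewrite /char_poly_mx map_mxM.
move/(congr1 determinant); rewrite det_mulmx det_lblock det_ublock.
by rewrite det1 mul1r !det_scalar.
Qed.

(** * Characteristic polynomial of a matrix supported on two centers *)

Section TwoCenters.
Variables (R : comNzRingType) (n : nat) (A : 'M[R]_n) (a b : 'I_n).
Hypotheses (neq_ab : a != b) (Aaa : A a a = 0) (Abb : A b b = 0).
Hypothesis Aleaf : forall i j, i \notin pred2 a b -> j \notin pred2 a b -> A i j = 0.
(** No leaf is joined to both centers: this makes the block [V1 *m U2] diagonal. *)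
Hypothesis Aaib : forall i, i \notin pred2 a b -> A a i * A i b = 0.
Hypothesis Abia : forall i, i \notin pred2 a b -> A b i * A i a = 0.

Let S c := \sum_(i | i \notin pred2 a b) A c i * A i c.

Let c (k : 'I_2) := if k == 0 then a else b.
(** [U1 *m V1] carries the center rows of [A], and [U2 *m V2] the leaf rows, which vanish outside
    the columns [a] and [b]. *)
Let U1 : 'M[R]_(n, 2) := \matrix_(i, k) (i == c k)%:R.
Let V1 : 'M[R]_(2, n) := \matrix_(k, j) A (c k) j.
Let U2 : 'M[R]_(n, 2) :=
  \matrix_(i, k) (if i \notin pred2 a b then A i (c k) else 0).
Let V2 : 'M[R]_(2, n) := \matrix_(k, j) (j == c k)%:R.

Let factorA : A = row_mx U1 U2 *m col_mx V1 V2.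
Proof.
rewrite mul_row_col; apply/matrixP=> i j; rewrite !mxE !big_ord_recl !big_ord0.
rewrite !mxE /c /= !inE !addr0.
have [->|ia] := eqVneq i a; first by rewrite (negPf neq_ab) !mul0r !mul1r !addr0.
have [->|ib] := eqVneq i b; first by rewrite !mul0r mul1r !addr0 add0r.
rewrite !mul0r !add0r.
have [->|ja] := eqVneq j a; first by rewrite (negPf neq_ab) mulr1 mulr0 addr0.
have [->|jb] := eqVneq j b; first by rewrite mulr1 mulr0 add0r.
by rewrite !mulr0 addr0 Aleaf // !inE negb_or ?ia ?ib ?ja ?jb.
Qed.

Let P : 'M[R]_2 := \matrix_(k, l) A (c k) (c l).
Let D : 'M[R]_2 := \matrix_(k, l) (if k == l then S (c k) else 0).

Let sum_delta (F : 'I_n -> R) d : \sum_j F j * (j == d)%:R = F d.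
Proof.
rewrite (bigD1 d) //= eqxx mulr1 big1 ?addr0 // => j /negPf->.
by rewrite mulr0.
Qed.

Let c_inj : injective c.
Proof.
move=> k l; rewrite /c; case: k => -[|[|k]] // hk; case: l => -[|[|l]] // hl /=;
  move=> H; try exact: val_inj; by move: neq_ab; rewrite H eqxx.
Qed.

Let factorC : col_mx V1 V2 *m row_mx U1 U2 = block_mx P D 1%:M 0.
Proof.
rewrite mul_col_row; congr block_mx; apply/matrixP=> k l; rewrite !mxE.
- by under eq_bigr do rewrite !mxE; rewrite sum_delta.
- under eq_bigr do rewrite !mxE.
  rewrite (bigID (fun i => i \notin pred2 a b)) /= addrC big1 ?add0r; last first.
    by move=> i /negPf->; rewrite mulr0.
  under eq_bigr => i il do rewrite il.
  case: eqP => [->|kl]; first by [].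
  apply: big1 => i il; rewrite /c.
  by move: kl; case: k => -[|[|k]] // hk; case: l => -[|[|l]] // hl;
    rewrite /= => kl; rewrite ?Aaib ?Abia //; case: kl; apply: val_inj.
- under eq_bigr do rewrite !mxE.
  by rewrite sum_delta (inj_eq c_inj) eq_sym.
(* [V2] selects the center rows, where [U2] is zero. *)
- rewrite big1 // => i _; rewrite !mxE !inE /c.
  case: (k == 0); have [->|_] := eqVneq i; rewrite ?mul0r ?eqxx ?orbT ?mulr0 //.
Qed.

Let det2 (M : 'M[{poly R}]_2) : \det M = M 0 0 * M 1 1 - M 0 1 * M 1 0.
Proof.
rewrite (expand_det_row _ 0) !big_ord_recl big_ord0 addr0 /cofactor !det_mx11.
rewrite !mxE /=.
have -> : lift 0 0 = 1 :> 'I_2 by apply: val_inj.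
have -> : lift 1 0 = 0 :> 'I_2 by apply: val_inj.
by rewrite expr0 expr1 mul1r mulN1r mulrN.
Qed.

Let char_core : char_poly (block_mx P D 1%:M 0) =
  'X^4 - (A a b * A b a + S a + S b) *: 'X^2 + (S a * S b)%:P.
Proof.
pose P' := map_mx polyC P; pose D' := map_mx polyC D.
(* The right factor clears the lower left block [-1]; its determinant ['X^2] also appears on the
   right and is cancelled. *)
have /(congr1 determinant) :
    char_poly_mx (block_mx P D 1%:M 0) *m block_mx 'X%:M 0 1%:M 1%:M =
    block_mx ('X%:M *m ('X%:M - P') - D') (- D') 0 'X%:M.
  rewrite /char_poly_mx scalar_mx_block map_block_mx opp_block_mx add_block_mx.
  rewrite mulmx_block !mulmx1 !mulmx0 !add0r map_mx1 map_mx0 oppr0 addr0.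
  by rewrite mulNmx mul1mx addNr mul_scalar_mx mul_mx_scalar.
rewrite det_mulmx det_lblock det_ublock det1 mulr1.
rewrite -/(char_poly _) det_scalar => /(monic_rreg (monicXn _ 2)) ->.
rewrite det2 mul_scalar_mx !mxE /c /=.
rewrite Aaa Abb -mul_polyC !(polyCM, polyCD) polyC0 !mulr1n !mulr0n !exprS expr0.
ring.
Qed.

Lemma char_poly_two_centers : 'X^4 * char_poly A =
  'X^n * ('X^4 - (A a b * A b a + S a + S b) *: 'X^2 + (S a * S b)%:P).
Proof. by rewrite -char_core -factorC -char_poly_mulmxC -factorA. Qed.

End TwoCenters.

(** * Shape of a double star *)

Section DoubleStar.
Variables (n : nat) (G : sgraph n).

(** The exclusive or says that every other vertex hangs on exactly one center. *)
Definition double_star_at (a b : 'I_n) : Prop :=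
  [/\ adj G a b,
      forall i, i \notin pred2 a b -> adj G a i (+) adj G b i
    & forall i j, i \notin pred2 a b -> j \notin pred2 a b -> ~~ adj G i j].

Lemma double_starP : double_star G ->
  (4 <= n)%N /\ exists a b, double_star_at a b.
Proof.
case=> -[_ conn _] /eqP/cards2P[a [b [neq_ab /setP degN1]]].
have deg1 i : i \notin pred2 a b -> degree G i == 1%N.
  by move=> il; have := degN1 i; rewrite !inE in il *; rewrite (negPf il) => /negbFE.
have nbr_uniq i x y : i \notin pred2 a b -> adj G i x -> adj G i y -> x = y.
  move=> /deg1/cards1P[z /setP Nz] ix iy.
  have := Nz x; have := Nz y; rewrite !inE ix iy.
  by move=> /esym/eqP-> /esym/eqP->.
have csym : connect_sym (adj G) by apply: sym_connect_sym; apply: adj_sym.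
(* Connectedness in usable form: a nonempty set of vertices closed under adjacency is everything. *)
have clP (p : {pred 'I_n}) x y :
    (forall u v, adj G u v -> u \in p -> v \in p) -> x \in p -> y \in p.
  move=> pcl; rewrite (closed_connect (intro_closed csym pcl) (conn x y)); exact.
(* Two adjacent leaves would form a closed set missing [a]. *)
have leaves i j : i \notin pred2 a b -> j \notin pred2 a b -> ~~ adj G i j.
  move=> il jl; apply/negP => ij.
  have : a \in pred2 i j.
    apply: (clP _ i); last by rewrite !inE eqxx.
    move=> u v uv; rewrite !inE => /orP[] /eqP uE; rewrite uE in uv.
      by rewrite (nbr_uniq _ _ _ il uv ij) eqxx orbT.
    by rewrite adj_sym in ij; rewrite (nbr_uniq _ _ _ jl uv ij) eqxx.
  by rewrite !inE in il jl *; case/orP => /eqP aE; rewrite -?aE eqxx in il jl.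
have adjl i : i \notin pred2 a b -> adj G a i (+) adj G b i.
  move=> il; have /cards1P[z /setP/(_ z)] := deg1 _ il.
  rewrite !inE eqxx => iz.
  have : z \in pred2 a b by apply: contraLR iz => zl; apply: leaves.
  rewrite ![adj G _ i]adj_sym !inE => /orP[] /eqP zE; rewrite zE in iz; rewrite iz.
    by case ib: (adj G i b) => //; move: neq_ab;
      rewrite (nbr_uniq _ _ _ il iz ib) eqxx.
  by case ia: (adj G i a) => //; move: neq_ab;
    rewrite (nbr_uniq _ _ _ il iz ia) eqxx.
have ab : adj G a b.
  apply/negPn/negP => nab.
  (* If the centers were not adjacent, [a] with its leaves would be a closed set missing [b]. *)
  pose p := [pred x | (x == a) || (x \notin pred2 a b) && adj G a x].
  have : b \in p.
    apply: (clP _ a); last by rewrite !inE eqxx.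
    move=> u v uv; rewrite !inE => /orP[/eqP uE|/andP[ul au]].
      rewrite uE in uv; rewrite uv andbT; case: eqP => //= _.
      by apply: contraNneq nab => <-.
    by rewrite adj_sym in au; rewrite (nbr_uniq _ _ _ ul uv au) eqxx.
  by rewrite !inE eqxx orbT orbF eq_sym (negPf neq_ab).
(* Without a leaf, [c] would have [d] as its only neighbor, hence degree 1. The form in [c], [d]
   serves both centers. *)
have leaf_of c d : c != d -> pred2 a b =i pred2 c d -> adj G c d ->
    exists2 i, i \notin pred2 a b & adj G c i.
  move=> neq_cd eq_cd cd.
  case: (pickP [pred i | i \notin pred2 a b & adj G c i]) => [i /andP[]|no].
    by exists i.
  have := degN1 c; rewrite !inE; have := eq_cd c; rewrite !inE eqxx /= => ->.
  move/negP; case; apply/cards1P; exists d; apply/setP => w; rewrite !inE.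
  have [->|wd] := eqVneq w d; first exact: cd.
  have [->|wc] := eqVneq w c; first exact: adj_irr.
  by have := no w; rewrite /= eq_cd !inE negb_or wc wd.
split; last by exists a, b.
have [i il ai] := leaf_of a b neq_ab (fun _ => erefl) ab.
have [j jl bj] : exists2 i, i \notin pred2 a b & adj G b i.
  apply: (leaf_of b a); rewrite 1?eq_sym // 1?adj_sym // => x.
  by rewrite !inE orbC.
have : uniq [:: a; b; i; j].
  move: il jl; rewrite /= !inE !negb_or neq_ab /= ![_ == i]eq_sym ![_ == j]eq_sym.
  move=> /andP[ia ib] /andP[-> ->]; rewrite ia ib !andbT /=.
  apply/eqP => ij; rewrite ij in bj; have := adjl i.
  by rewrite ai bj !inE negb_or ia ib => /(_ isT).
by move=> /card_uniqP card4; rewrite -[n]card_ord -[4%N]/(size [:: a; b; i; j])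
  -card4 max_card.
Qed.
End DoubleStar.

(** * Edges and 2-matchings of a double star *)

Section DoubleStarEdges.
Variables (n : nat) (G : sgraph n) (a b : 'I_n).
Hypothesis dsG : double_star_at G a b.

Lemma centers_neq : a != b.
Proof. by case: dsG => ab _ _; apply: contraTneq ab => <-; rewrite adj_irr. Qed.

(* The values at [a] are irrelevant: [parent] roots the tree at [a]. *)
Definition parent i := if adj G a i then a else b.

Definition leaves_of c := [set i | i \notin pred2 a b & adj G c i].

Lemma adj_parent i : i != a -> adj G i (parent i).
Proof.
case: dsG => ab adjl _ ia; rewrite /parent adj_sym; case: ifPn => // nai.
have [iE|ib] := eqVneq i b; first by rewrite iE ab in nai.
by have := adjl i; rewrite !inE negb_or ia ib (negPf nai) => /(_ isT).
Qed.

(** If distinct [i], [j] gave the same edge, each would be the parent of the other; parents other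
    than [a] equal [b], so [i = j = b]. *)
Lemma parent_edge_inj :
  {in predC1 a &, injective (fun i => [set i; parent i])}.
Proof.
move=> i j; rewrite !inE => ia ja /setP eq_ij.
have := eq_ij i; have := eq_ij j; rewrite !inE !eqxx /= /parent.
have [//|_] := eqVneq i j; case: ifP => _; first by rewrite (negPf ja).
move=> /eqP->; case: ifP => _; first by rewrite (negPf ia).
by move/esym/eqP.
Qed.

(** Each edge is indexed by its end farther from the root [a]: a leaf gives its pendant edge, [b]
    the central edge. *)
Lemma edges_double_star :
  edges G = [set [set i; parent i] | i in predC1 a].
Proof.
case: dsG => ab adjl noll; apply/setP => e; rewrite inE.
apply/existsP/imsetP => [[u /existsP[v /andP[uv /eqP->]]]|[i ia ->]]; last first.
  by exists i; apply/existsP; exists (parent i); rewrite adj_parent ?eqxx.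
have upE x y : x \notin pred2 a b -> adj G x y -> y = parent x.
  move=> xl xy; have := adjl x xl; rewrite /parent ![adj G _ x]adj_sym.
  have : y \in pred2 a b by apply: contraLR xy => yl; apply: noll.
  by case/orP=> /eqP yE; rewrite yE in xy; rewrite xy ?addbT // => /negPf->.
have [ul|] := boolP (u \notin pred2 a b).
  exists u; last by rewrite -(upE u v).
  by move: ul; rewrite !inE negb_or => /andP[].
rewrite negbK => uc; rewrite adj_sym in uv; rewrite setUC.
have [vl|] := boolP (v \notin pred2 a b).
  exists v; last by rewrite -(upE v u).
  by move: vl; rewrite !inE negb_or => /andP[].
rewrite negbK => vc.
have -> : [set v; u] = [set b; a].
  case/orP: vc uv => /eqP->; case/orP: uc => /eqP->; rewrite ?adj_irr //.
  by rewrite setUC.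
by exists b; rewrite ?inE /= 1?eq_sym ?centers_neq // /parent ab.
Qed.

(** The center [b] also has parent [a], so it has to be excluded. *)
Lemma in_leavesa_parent i : i != a ->
  (i \in leaves_of a) = (i != b) && (parent i == a).
Proof.
move=> ia; rewrite !inE negb_or ia /=; congr (_ && _); rewrite /parent.
by case: ifP; rewrite ?eqxx // eq_sym (negPf centers_neq).
Qed.

Lemma in_leavesb_parent i : i != a -> (i \in leaves_of b) = (parent i == b).
Proof.
case: dsG => ab adjl _ ia; rewrite !inE negb_or ia /= /parent.
have [->|ib] := eqVneq i b; first by rewrite ab (negPf centers_neq).
have := adjl i; rewrite !inE negb_or ia ib => /(_ isT).
by case: (adj G a i) => /= [/negPf->|->]; rewrite ?(negPf centers_neq) ?eqxx.
Qed.

(** Disjoint edges have different parents, one [a] and the other [b]. The edge with parent [a] is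
    not the central one, as that contains [b]. *)
Lemma matchings2_double_star : matchings G 2 =
  [set [set [set p.1; a]; [set p.2; b]] | p in setX (leaves_of a) (leaves_of b)].
Proof.
have ab := centers_neq.
apply/setP => M; rewrite inE.
apply/and3P/imsetP => [[/subsetP sM /trivIsetP tM /cards2P[e1 [e2 [ne12 ME]]]]|].
  have e1M : e1 \in M by rewrite ME set21.
  have e2M : e2 \in M by rewrite ME set22.
  have dis := tM _ _ e1M e2M ne12.
  have := sM _ e1M; have := sM _ e2M; rewrite edges_double_star.
  move=> /imsetP[j ja e2E] /imsetP[i ia e1E]; rewrite !inE in ia ja.
  have meet x : x \in e1 -> x \in e2 -> False.
    by move=> x1; rewrite (disjointFr dis x1).
  have ends i0 : i0 != a -> parent i0 = a \/ parent i0 = b.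
    by rewrite /parent; case: ifP; [left | right].
  (* The edges of [M] come unordered; this treats both orders at once. *)
  have main i0 j0 : i0 != a -> j0 != a -> parent i0 = a -> parent j0 = b ->
      (forall x, x \in [set i0; parent i0] -> x \in [set j0; parent j0] -> False) ->
      exists2 p, p \in setX (leaves_of a) (leaves_of b) &
        [set [set i0; parent i0]; [set j0; parent j0]] =
        [set [set p.1; a]; [set p.2; b]].
    move=> ia0 ja0 pi pj mt; exists (i0, j0); last by rewrite /= pi pj.
    rewrite inE /= in_leavesa_parent // in_leavesb_parent // pi pj !eqxx !andbT.
    by apply/eqP => i0b; apply: (mt b); rewrite ?pj ?set22 // i0b set21.
  case: (ends i ia) => pi; case: (ends j ja) => pj.
  - by case: (meet a); rewrite ?e1E ?e2E ?pi ?pj set22.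
  - by rewrite ME e1E e2E; apply: main => // x; rewrite -e1E -e2E; apply: meet.
  - rewrite ME setUC e1E e2E; apply: main => // x; rewrite -e1E -e2E => x2 x1.
    exact: meet x1 x2.
  - by case: (meet b); rewrite ?e1E ?e2E ?pi ?pj set22.
case=> -[i j]; rewrite inE /= => /andP[iL jL] ->.
have [ia ja] : i != a /\ j != a.
  by move: iL jL; rewrite !inE !negb_or => /andP[/andP[-> _] _] /andP[/andP[-> _] _].
move: iL jL; rewrite in_leavesa_parent // in_leavesb_parent //.
move=> /andP[ib /eqP pi] /eqP pj.
have nij : i != j by apply: contraNneq ab => ij; rewrite -pi ij pj.
have dis : [disjoint [set i; a] & [set j; b]].
  rewrite disjoints_subset; apply/subsetP => x; rewrite !inE.
  by case/orP => /eqP->; rewrite negb_or ?nij ?ib // eq_sym ja ab.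
(* Disjoint nonempty sets are distinct, so the matching has two elements. *)
have ne : [set i; a] != [set j; b].
  apply: contraTneq dis => ->; apply/negP => /disjointFr/(_ (set21 _ _)).
  by rewrite set21.
split; last by rewrite cards2 ne.
  apply/subsetP => e; rewrite edges_double_star !inE => /orP[] /eqP->.
    by apply/imsetP; exists i; rewrite ?inE ?pi.
  by apply/imsetP; exists j; rewrite ?inE ?pj.
apply/trivIsetP => e e'; rewrite !inE => /orP[] /eqP-> /orP[] /eqP->.
all: rewrite ?eqxx //.
by rewrite disjoint_sym.
Qed.

(** Only the first edge contains [a] and only the second contains [b], so both edges, then both
    leaves, can be read off the set. *)
Lemma leaf_pair_inj : {in setX (leaves_of a) (leaves_of b) &,
  injective (fun p => [set [set p.1; a]; [set p.2; b]])}.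
Proof.
have ab := centers_neq.
move=> [i j] [i' j']; rewrite !inE !negb_or /=.
move=> /andP[/andP[/andP[ia ib] _] /andP[/andP[ja jb] _]].
move=> /andP[/andP[/andP[ia' ib'] _] /andP[/andP[ja' jb'] _]] /setP eqM.
have := eqM [set i; a]; rewrite !inE eqxx => /esym/orP[] /eqP/setP eqi; last first.
  by have := eqi a; rewrite !inE eqxx orbT [a == j']eq_sym (negPf ja') (negPf ab).
have := eqM [set j; b]; rewrite !inE eqxx orbT => /esym/orP[] /eqP/setP eqj.
  have := eqj b; rewrite !inE eqxx orbT [b == i']eq_sym (negPf ib').
  by rewrite eq_sym (negPf ab).
have := eqi i; have := eqj j; rewrite !inE !eqxx (negPf ia) (negPf jb) !orbF.
by move=> /esym/eqP-> /esym/eqP->.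
Qed.

End DoubleStarEdges.

(** * Identification of the coefficients *)

Section Coefficients.
Variables (F : fieldType) (f : F -> F) (n : nat) (Phi : skew_gain_graph f n).
Hypothesis hf : anti_involution f.
Variables a b : 'I_n.
Hypothesis dsG : double_star_at (ugraph Phi) a b.
Let A := gain_adjmx Phi.
Let L := leaves_of (ugraph Phi) a b.

Lemma gain_adjmx_edge i j : adj (ugraph Phi) i j ->
  A i j * A j i = edge_g Phi [set i; j].
Proof.
by move=> ij; rewrite edge_gE // !mxE ij adj_sym ij (gain_rev ij).
Qed.

Lemma sum_leaves c : \sum_(i | i \notin pred2 a b) A c i * A i c =
  \sum_(i in L c) edge_g Phi [set i; c].
Proof.
rewrite (bigID (adj (ugraph Phi) c)) /= [X in _ + X]big1 ?addr0; last first.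
  by move=> i /andP[_ ci]; rewrite mxE (negPf ci) mul0r.
apply: eq_big => [i|i /andP[_ ci]]; first by rewrite in_set.
by rewrite gain_adjmx_edge // setUC.
Qed.

Lemma coef_a2_double_star : coef_a2 Phi =
  A a b * A b a + \sum_(i in L a) edge_g Phi [set i; a] +
  \sum_(i in L b) edge_g Phi [set i; b].
Proof.
have [ab adjl _] := dsG; have neq_ab := centers_neq dsG.
rewrite /coef_a2 (edges_double_star dsG) (big_imset _ (@parent_edge_inj _ _ _ b)) /=.
(* The term of [b] is the central edge; the other indices are the leaves. *)
rewrite (bigD1 b) /=; last by rewrite inE eq_sym.
rewrite {1}/parent ab setUC -gain_adjmx_edge // -addrA; congr (_ + _).
rewrite -!sum_leaves -big_split /=; apply: eq_big => i.
  by rewrite !inE negb_or.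
rewrite inE => /andP[ia ib].
have := adjl i; rewrite !inE negb_or ia ib => /(_ isT) pi.
rewrite -gain_adjmx_edge ?(adj_parent dsG) // /parent mulrC.
(* Of the two products at a leaf, the one with the non-adjacent center is zero. *)
case: ifP pi => [ai /= /negPf bi|ai /= bi].
  by rewrite [A b i]mxE bi mul0r addr0.
by rewrite [A a i]mxE ai mul0r add0r.
Qed.

Lemma coef_a4_double_star : coef_a4 Phi =
  (\sum_(i in L a) edge_g Phi [set i; a]) *
  (\sum_(i in L b) edge_g Phi [set i; b]).
Proof.
have neq_ab := centers_neq dsG.
rewrite /coef_a4 (matchings2_double_star dsG) (big_imset _ (leaf_pair_inj dsG)) /=.
rewrite mulr_suml; under [RHS]eq_bigr do rewrite mulr_sumr.
rewrite pair_big /=; apply: eq_big => [p|p pL]; first by rewrite inE.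
(* The product over the matching splits once its edges are distinct: only the first contains [a]. *)
rewrite big_setU1 ?big_set1 //= inE.
move: pL; rewrite !inE !negb_or => /andP[_ /andP[/andP[ja _] _]].
apply/negP => /eqP/setP/(_ a); rewrite !inE eqxx orbT.
by rewrite [a == p.2]eq_sym (negPf ja) (negPf neq_ab).
Qed.

Lemma char_poly_double_star : (4 <= n)%N -> char_poly A =
  'X^n - coef_a2 Phi *: 'X^(n - 2) + coef_a4 Phi *: 'X^(n - 4).
Proof.
move=> n4; have [ab adjl noll] := dsG.
apply: (monic_lreg (monicXn _ 4)) => /=.
rewrite (@char_poly_two_centers _ _ _ a b); first last.
- move=> i il; have := adjl i il; rewrite !mxE [_ i a]adj_sym.
  by case: (adj _ a i) => /= [/negPf->|]; rewrite ?mul0r ?mulr0.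
- move=> i il; have := adjl i il; rewrite !mxE [_ i b]adj_sym.
  by case: (adj _ a i) => /= [/negPf->|]; rewrite ?mul0r ?mulr0.
- by move=> i j il jl; rewrite mxE (negPf (noll _ _ il jl)).
- by rewrite mxE adj_irr.
- by rewrite mxE adj_irr.
- exact: centers_neq dsG.
rewrite !sum_leaves -coef_a2_double_star -coef_a4_double_star.
(* Subtraction is truncated; [n4] gives the exponents their intended values. *)
have e2 : (n - 2 = 2 + (n - 4))%N by lia.
have en : 'X^n = 'X^(4 + (n - 4)) :> {poly F} by rewrite subnKC.
rewrite -!mul_polyC e2 en !exprD.
ring.
Qed.
End Coefficients.

(** * Eigenvalues from the biquadratic factor *)

Section BiquadraticSpectrum.
Variables (K : fieldType) (n : nat) (B : 'M[K]_n) (p q s r1 r2 : K).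
Hypotheses (n4 : (4 <= n)%N) (char2 : 2%:R != 0 :> K).
Hypothesis charB : char_poly B = 'X^n - p *: 'X^(n - 2) + q *: 'X^(n - 4).
Hypotheses (sE : s ^+ 2 = p ^+ 2 - 4%:R * q)
  (r1E : r1 ^+ 2 = (p - s) / 2%:R) (r2E : r2 ^+ 2 = (p + s) / 2%:R).

(** By Vieta, [r1 ^+ 2] and [r2 ^+ 2] are the roots of t^2 - p t + q, so the characteristic
    polynomial splits into the listed linear factors. *)
Lemma biquadratic_eigenvalue_list :
  eigenvalue_list B ([:: r1; - r1; r2; - r2] ++ nseq (n - 4) 0).
Proof.
have fact : char_poly B =
    \prod_(z <- [:: r1; - r1; r2; - r2] ++ nseq (n - 4) 0) ('X - z%:P).
  have pE : p = r1 ^+ 2 + r2 ^+ 2 by rewrite r1E r2E; field.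
  have qE : q = r1 ^+ 2 * r2 ^+ 2.
    (* After multiplication by 4, the claim is p^2 - s^2 = (p - s)(p + s). *)
    apply: (mulfI (mulf_neq0 char2 char2)).
    have -> : 2%:R * 2%:R * q = p ^+ 2 - s ^+ 2 by rewrite sE; ring.
    by rewrite r1E r2E; field.
  rewrite big_cat big_nseq !big_cons big_nil /= mulr1 iter_mulr_1 subr0.
  have e2 : (n - 2 = 2 + (n - 4))%N by lia.
  rewrite charB pE qE -!mul_polyC !polyCN !(polyCD, polyCM, rmorphXn).
  rewrite e2 -{1}(subnKC n4) !exprD.
  ring.
split=> z; last by rewrite /alg_mult fact mu_prod_XsubC.
by rewrite -topredE /= eigenvalue_root_char fact root_prod_XsubC.
Qed.

End BiquadraticSpectrum.

Theorem theorem3p3 (F : fieldType) (charF : [pchar F] =i pred0)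
    (f : F -> F) (hf : anti_involution f)
    (n : nat) (Phi : skew_gain_graph f n) (hG : double_star (ugraph Phi)) :
  let a2 := coef_a2 Phi in
  let a4 := coef_a4 Phi in
  char_poly (gain_adjmx Phi) =
    'X^n - a2 *: 'X^(n - 2) + a4 *: 'X^(n - 4)
  /\
  forall (K : closedFieldType) (iota : {rmorphism F -> K}),
    is_algebraic_closure iota ->
    forall s r1 r2 : K,
      s ^+ 2 = iota (a2 ^+ 2 - 4%:R * a4) ->
      r1 ^+ 2 = (iota a2 - s) / 2%:R ->
      r2 ^+ 2 = (iota a2 + s) / 2%:R ->
      eigenvalue_list (map_mx iota (gain_adjmx Phi))
        ([:: r1; - r1; r2; - r2] ++ nseq (n - 4) 0).
Proof.
move=> a2 a4; have [n4 [a [b dsG]]] := double_starP hG.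
have charA := char_poly_double_star hf dsG n4.
split=> // K iota _ s r1 r2 sE r1E r2E.
apply: (@biquadratic_eigenvalue_list _ _ _ (iota a2) (iota a4) s) => //.
(* Characteristic zero gives 2 nonzero in [F], and [iota] is injective. *)
- by rewrite -(rmorph_nat iota) fmorph_eq0; have := charF 2; rewrite !inE /= => ->.
- by rewrite -map_char_poly charA /= rmorphD rmorphB /= !map_polyZ !map_polyXn.
- by rewrite sE rmorphB rmorphXn rmorphM rmorph_nat.
Qed.
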